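(* Let $E,Q\in M_n(\mathbb C)$ and suppose that $E^TQ$ is either symmetric or skew-symmetric. Then there exist $U,V\in GL_n(\mathbb C)$ and a positive integer $f$ such that $$(UEV,U^{-T}QV)=\bigoplus_{i=1}^{f}(A_i,B_i),$$ where each $(A_i,B_i)\in\{(1,0),(0,1),(0,0),(G_1^T,F_1^T)\oplus(G_0,F_0),(M,N)\}$ and $$(M,N)=\begin{cases}(1,1),&\text{if }E^TQ\text{ is symmetric},\\(I_2,H_2(-1)),&\text{if }E^TQ\text{ is skew-symmetric}.\end{cases}$$ This canonical form is determined uniquely by $(E,Q)$ up to permutation of pairs of summands. Moreover, if the columns of $\begin{bmatrix}E\\Q\end{bmatrix}$ span a Lagrangian subspace of $\mathbb C^{2n}$, then the canonical summands are of type $(1,0)$, $(0,1)$, or $(1,1)$.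
   Context: $M_n(\mathbb C)$ is the set of $n\times n$ complex matrices, $GL_n(\mathbb C)$ the nonsingular ones, $A^{-T}=(A^{-1})^T$. The direct sum of pairs is $(A,B)\oplus(C,D):=(A\oplus C,B\oplus D)$, where $\oplus$ on matrices is the block-diagonal direct sum. $H_2(-1)=\begin{bmatrix}0&1\\-1&0\end{bmatrix}$. $F_k$ and $G_k$ are the $k\times(k+1)$ matrices with $F_k=[\,0\ \ I_k\,]$, $G_k=[\,I_k\ \ 0\,]$; $F_0=G_0$ is the $0\times1$ matrix, so that $(G_1^T,F_1^T)\oplus(G_0,F_0)=\left(\begin{bmatrix}1&0\\0&0\end{bmatrix},\begin{bmatrix}0&0\\1&0\end{bmatrix}\right)$. $(1,0),(0,1),(0,0),(1,1)$ are pairs of $1\times1$ matrices. A Lagrangian subspace is an $n$-dimensional subspace $S\subset\mathbb C^{2n}$ such that $s^T\begin{bmatrix}0&I_n\\-I_n&0\end{bmatrix}t=0$ for all $s,t\in S$. *)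

(* Defs.v *)
From mathcomp Require Import all_boot all_order all_algebra.
From mathcomp Require Import reals.
From mathcomp Require Export complex.
Set Implicit Arguments.
Unset Strict Implicit.
Unset Printing Implicit Defensive.
Import GRing.Theory.
Local Open Scope ring_scope.

Section Pairs.
Variable F : fieldType.

(* A pair of square matrices together with their common size, so that pairs of
   different sizes can be compared and collected in sequences. *)
Definition mxpair := {k : nat & ('M[F]_k * 'M[F]_k)%type}.

Definition mkpair (k : nat) (A B : 'M[F]_k) : mxpair :=
  Tagged (fun k => ('M[F]_k * 'M[F]_k)%type) (A, B).

Definition psize (p : mxpair) : nat := tag p.
Definition pfst (p : mxpair) : 'M[F]_(psize p) := (tagged p).1.
Definition psnd (p : mxpair) : 'M[F]_(psize p) := (tagged p).2.

Definition bigdsum (f : nat) (s : f.-tuple mxpair) : mxpair :=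
  mkpair (\mxdiag_(i < f) pfst (tnth s i)) (\mxdiag_(i < f) psnd (tnth s i)).

Definition Fmx (k : nat) : 'M[F]_(k, k.+1) := row_mx (0 : 'cV_k) 1%:M.
Definition Gmx (k : nat) : 'M[F]_(k, k.+1) :=
  castmx (erefl k, addn1 k) (row_mx 1%:M (0 : 'cV_k)).

(* The blocks of (G_1^T, F_1^T) (+) (G_0, F_0) are 2 x 1 and 0 x 1, hence the
   direct sum is a pair of square matrices of size 2. *)
Definition singpair : mxpair :=
  @mkpair 2 (block_mx (Gmx 1)^T 0 0 (Gmx 0) : 'M_(2 + 0, 1 + 1))
            (block_mx (Fmx 1)^T 0 0 (Fmx 0) : 'M_(2 + 0, 1 + 1)).

Lemma singpairE :
  singpair = @mkpair 2 (\matrix_(i, j) ((i == 0) && (j == 0))%:R)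
                       (\matrix_(i, j) ((i == 1) && (j == 0))%:R).
Proof.
rewrite /singpair; congr mkpair; apply/matrixP => i j;
  case: i => [[|[|//]] ?]; case: j => [[|[|//]] ?]; rewrite [RHS]mxE /block_mx mxE;
  do 2 (case: splitP => [[[|[|?]] ?]|[[|?] ?]] //= _; rewrite mxE) => //;
  rewrite ?castmxE /row_mx mxE; case: splitP => [[[|?] ?]|[[|?] ?]] //= _;
  by rewrite mxE.
Qed.

Definition scalarpair (a b : F) : mxpair := @mkpair 1 a%:M b%:M.

Definition H2 (a : F) : 'M[F]_2 :=
  block_mx (0 : 'M_1) 1%:M a%:M (0 : 'M_1).

Variant symmetry_case := Symmetric | SkewSymmetric.

Definition has_symmetry (c : symmetry_case) n (A : 'M[F]_n) : Prop :=
  match c with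
  | Symmetric => A \is symmetricmx
  | SkewSymmetric => A \is skewmx
  end.

Definition MNpair (c : symmetry_case) : mxpair :=
  match c with
  | Symmetric => scalarpair 1 1
  | SkewSymmetric => mkpair 1%:M (H2 (-1))
  end.

Definition summand_types (c : symmetry_case) : seq mxpair :=
  [:: scalarpair 1 0; scalarpair 0 1; scalarpair 0 0; singpair; MNpair c].

Definition canonical_form (c : symmetry_case) n (E Q : 'M[F]_n)
    (f : nat) (s : f.-tuple mxpair) : Prop :=
  [/\ (0 < f)%N,
      {subset s <= summand_types c} &
      exists U V : 'M[F]_n, [/\ U \in unitmx, V \in unitmx &
        mkpair (U *m E *m V) ((invmx U)^T *m Q *m V) = bigdsum s]].

Definition sympl_mx n : 'M[F]_(n + n) := block_mx 0 1%:M (- 1%:M) 0.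

Definition lagrangian n (S : {vspace 'cV[F]_(n + n)}) : Prop :=
  \dim S = n /\
  {in S &, forall s t : 'cV[F]_(n + n), s^T *m sympl_mx n *m t = 0}.

Definition colspan m n (A : 'M[F]_(m, n)) : {vspace 'cV[F]_m} :=
  <<[seq col j A | j <- enum 'I_n]>>%VS.

End Pairs.

(* Main.v *)
Require Import Defs.
From mathcomp Require Import all_boot all_order all_algebra.
From mathcomp Require Import boolp reals.
From mathcomp Require Import zify.
Set Implicit Arguments.
Unset Strict Implicit.
Unset Printing Implicit Defensive.
Import Order.TTheory GRing.Theory Num.Theory.
Local Open Scope ring_scope.
Local Open Scope complex_scope.

(* Existence. Bring [E] to [diag(I_r, 0)]; the symmetry of [E^T Q] then forces
   [Q = [A 0; B C]] with [A] (skew-)symmetric. Reducing [C] to [diag(I, 0)] and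
   clearing the corresponding rows of [B] splits off summands (0,1). A
   congruence exposing a nonsingular block [1] or [H_2(-1)] of [A], followed by
   clearing the columns of [B] below it, splits off (M,N). Once [A = 0] and
   [C = 0], reducing [B] to [diag(I, 0)] leaves singular pairs, (1,0)'s and
   (0,0)'s.
   Uniqueness. The size and the ranks of [E], [Q], [E^T Q] and [[E; Q]] are
   invariants that are additive under direct sums, and the multiplicity of each
   summand is a linear combination of them. For a Lagrangian column span,
   [[E; Q]] has rank [n], which excludes (0,0) and the singular pair, and
   [E^T Q] is symmetric, which excludes [(I_2, H_2(-1))]. *)

(** * Equivalence and direct sums of pairs, and two matrix factorizations *)

Section Equivalence.
Variable F : fieldType.
Implicit Types p q : mxpair F.

Definition mutual_inverse m n (A : 'M[F]_(m, n)) (B : 'M[F]_(n, m)) :=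
  A *m B = 1%:M /\ B *m A = 1%:M.

Lemma mutual_inverse_unit n (A : 'M[F]_n) :
  A \in unitmx -> mutual_inverse A (invmx A).
Proof. by split; [rewrite mulmxV | rewrite mulVmx]. Qed.

Lemma mutual_inverse_eq m n (A : 'M[F]_(m, n)) B : mutual_inverse A B -> m = n.
Proof.
by case=> AB BA; apply/eqP; rewrite eqn_leq (mulmx1_min AB) (mulmx1_min BA).
Qed.

Lemma mutual_inverse1 n : mutual_inverse (1%:M : 'M[F]_n) 1%:M.
Proof. by split; rewrite mulmx1. Qed.

Lemma mutual_inverse_sym m n (A : 'M[F]_(m, n)) B :
  mutual_inverse A B -> mutual_inverse B A.
Proof. by case. Qed.

Lemma mutual_inverse_tr m n (A : 'M[F]_(m, n)) B :
  mutual_inverse A B -> mutual_inverse A^T B^T.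
Proof. by case=> AB BA; split; rewrite -trmx_mul ?AB ?BA trmx1. Qed.

Lemma mutual_inverse_mul m n l (A : 'M[F]_(m, n)) B (C : 'M[F]_(n, l)) D :
  mutual_inverse A B -> mutual_inverse C D ->
  mutual_inverse (A *m C) (D *m B).
Proof.
case=> AB BA [CD DC]; split.
  by rewrite mulmxA -(mulmxA A) CD mulmx1.
by rewrite mulmxA -(mulmxA D) BA mulmx1.
Qed.

Lemma mutual_inverse_diag m n k l (A : 'M[F]_(m, n)) B (C : 'M[F]_(k, l)) D :
  mutual_inverse A B -> mutual_inverse C D ->
  mutual_inverse (block_mx A 0 0 C) (block_mx B 0 0 D).
Proof.
case=> AB BA [CD DC]; split; rewrite mulmx_block ?AB ?BA ?CD ?DC;
  by rewrite !(mulmx0, mul0mx, addr0, add0r) -scalar_mx_block.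
Qed.

Lemma mutual_inverse_lshear m n (Z : 'M[F]_(m, n)) :
  mutual_inverse (block_mx 1%:M 0 Z 1%:M) (block_mx 1%:M 0 (- Z) 1%:M).
Proof.
by split; rewrite mulmx_block !(mulmx0, mul0mx, mulmx1, mul1mx, addr0, add0r)
  ?subrr ?addNr -scalar_mx_block.
Qed.

(* Allowing [U] and [V] to be rectangular (hence square up to a cast) lets one
   compare pairs whose sizes are only propositionally equal. *)
Definition pequiv p q :=
  exists (U : 'M[F]_(psize q, psize p)) (U' : 'M[F]_(psize p, psize q))
         (V : 'M[F]_(psize p, psize q)) (V' : 'M[F]_(psize q, psize p)),
    [/\ mutual_inverse U U', mutual_inverse V V',
        pfst q = U *m pfst p *m V & psnd q = U'^T *m psnd p *m V].

Lemma pequiv_refl p : pequiv p p.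
Proof.
exists 1%:M, 1%:M, 1%:M, 1%:M.
by rewrite trmx1 !mulmx1 !mul1mx; split => //; exact: mutual_inverse1.
Qed.

Lemma pequiv_trans p q r : pequiv p q -> pequiv q r -> pequiv p r.
Proof.
move=> [U [U' [V [V' [iU iV Eq Qq]]]]] [X [X' [Y [Y' [iX iY Er Qr]]]]].
exists (X *m U), (U' *m X'), (V *m Y), (Y' *m V'); split.
- exact: mutual_inverse_mul.
- exact: mutual_inverse_mul.
- by rewrite Er Eq !mulmxA.
- by rewrite Qr Qq trmx_mul !mulmxA.
Qed.

Lemma pequiv_size0 p q : psize p = 0%N -> psize q = 0%N -> pequiv p q.
Proof.
case: p q => [m [E Q]] [n [E' Q']]; rewrite /psize /= => m0 n0; subst m n.
by exists 0, 0, 0, 0; split; try split; rewrite [LHS]flatmx0 [RHS]flatmx0.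
Qed.

Definition dsum p q : mxpair F :=
  mkpair (block_mx (pfst p) 0 0 (pfst q)) (block_mx (psnd p) 0 0 (psnd q)).

Definition dsums (s : seq (mxpair F)) : mxpair F := bigdsum (in_tuple s).

Lemma mkpair_cast m n (e : m = n) (A B : 'M[F]_m) :
  mkpair (castmx (e, e) A) (castmx (e, e) B) = mkpair A B.
Proof. by case: _ / e; rewrite !castmx_id. Qed.

Lemma bigdsum_val f (s : f.-tuple (mxpair F)) : bigdsum s = dsums s.
Proof.
rewrite /dsums; case: s => s i /=; have e := eqP i; subst f.
by congr bigdsum; apply: val_inj.
Qed.

Lemma psize_dsums_nil : psize (dsums [::]) = 0%N.
Proof. by rewrite /dsums /bigdsum /psize /= big_ord0. Qed.

(** This holds as an equality of sized pairs, so decompositions can be treated by induction on the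
    list of summands. *)
Lemma dsums_cons p s : dsums (p :: s) = dsum p (dsums s).
Proof.
(* Families indexed by functions rather than tuples let the tail be written with [lift ord0], the
   form produced by [mxdiag_recl]. *)
pose G f (t : 'I_f -> mxpair F) :=
  mkpair (\mxdiag_(i < f) pfst (t i)) (\mxdiag_(i < f) psnd (t i)).
have GS f (t : 'I_f.+1 -> mxpair F) :
    G _ t = dsum (t ord0) (G _ (fun i => t (lift ord0 i))).
  by rewrite /G !mxdiag_recl mkpair_cast.
rewrite /dsums /bigdsum -!/(G _ _) GS; congr (dsum _ (G _ _)).
by apply/funext => i; rewrite !(tnth_nth p).
Qed.

Lemma dsumA p q r : dsum p (dsum q r) = dsum (dsum p q) r.
Proof.
rewrite /dsum -(mkpair_cast (addnA _ _ _)) /pfst /psnd /=.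
by rewrite -col_mx0 -row_mx0 !block_mxA !castmx_comp !castmx_id col_mx0 row_mx0.
Qed.

Lemma dsum_size0l p q : psize p = 0%N -> dsum p q = q.
Proof.
case: p q => [m [E Q]] [n [E' Q']]; rewrite /psize /= => m0; subst m.
have e (i : 'I_n) : i = rshift 0 i by exact: val_inj.
by rewrite /dsum -[RHS]/(mkpair E' Q'); congr mkpair; apply/matrixP => i j;
  rewrite [in LHS](e i) [in LHS](e j) block_mxEdr.
Qed.

Lemma dsum_size0r p q : psize q = 0%N -> dsum p q = p.
Proof.
case: p q => [n [E Q]] [m [E' Q']]; rewrite /psize /= => m0; subst m.
rewrite /dsum -[RHS]/(mkpair E Q) -(mkpair_cast (addn0 n)).
have e i : cast_ord (esym (addn0 n)) i = lshift 0 i by exact: val_inj.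
by congr mkpair; apply/matrixP => i j; rewrite castmxE !e block_mxEul.
Qed.

Lemma pequiv_dsum p q p' q' :
  pequiv p p' -> pequiv q q' -> pequiv (dsum p q) (dsum p' q').
Proof.
move=> [U [U' [V [V' [iU iV Ep Qp]]]]] [X [X' [Y [Y' [iX iY Eq Qq]]]]].
exists (block_mx U 0 0 X), (block_mx U' 0 0 X').
exists (block_mx V 0 0 Y), (block_mx V' 0 0 Y').
split; try exact: mutual_inverse_diag.
  by rewrite /pfst /= -!/(pfst _) !mulmx_block Ep Eq
    !(mulmx0, mul0mx, addr0, add0r).
by rewrite /psnd /= -!/(psnd _) tr_block_mx !trmx0 !mulmx_block Qp Qq
    !(mulmx0, mul0mx, addr0, add0r).
Qed.

Lemma dsums_cat s t : dsum (dsums s) (dsums t) = dsums (s ++ t).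
Proof.
elim: s => [|p s IH] /=; first exact: dsum_size0l psize_dsums_nil.
by rewrite !dsums_cons -dsumA IH.
Qed.

Section Decomposable.
Variable T : seq (mxpair F).

Definition decomposable p := exists2 s, {subset s <= T} & pequiv p (dsums s).

Lemma decomposable_pequiv p q : pequiv p q -> decomposable q -> decomposable p.
Proof. by move=> pq [s sT qs]; exists s => //; exact: pequiv_trans pq qs. Qed.

Lemma decomposable_dsum p q :
  decomposable p -> decomposable q -> decomposable (dsum p q).
Proof.
move=> [s sT ps] [t tT qt]; exists (s ++ t).
  by move=> x; rewrite mem_cat => /orP[/sT|/tT].
by rewrite -dsums_cat; exact: pequiv_dsum.
Qed.

Lemma decomposable_size0 p : psize p = 0%N -> decomposable p.
Proof.
by move=> p0; exists [::] => //; exact: pequiv_size0 p0 psize_dsums_nil.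
Qed.

Lemma decomposable_mem p : p \in T -> decomposable p.
Proof.
move=> pT; exists [:: p] => [x|]; first by rewrite inE => /eqP ->.
by rewrite dsums_cons (dsum_size0r _ psize_dsums_nil); exact: pequiv_refl.
Qed.

Lemma decomposable_scalar (a b : F) n :
  scalarpair a b \in T -> decomposable (@mkpair F n a%:M b%:M).
Proof.
move=> abT; elim: n => [|n IH]; first exact: decomposable_size0.
have -> : @mkpair F n.+1 a%:M b%:M = dsum (scalarpair a b) (@mkpair F n a%:M b%:M).
  by rewrite /dsum -!(@scalar_mx_block _ 1 n).
by apply: decomposable_dsum => //; exact: decomposable_mem.
Qed.

End Decomposable.

(** Gaussian elimination writes [E] as [col_ebase E *m pid_mx r *m row_ebase E]; inverting the outer
    factors gives [P] and [R]. Sizes of the form [r + k] and [r + l] make the block shape available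
    without casts. *)
Lemma rank_normal_form m n (E : 'M[F]_(m, n)) :
  exists r k l (P : 'M_(r + k, m)) P' (R : 'M_(n, r + l)) R',
    [/\ mutual_inverse P P', mutual_inverse R R' &
        P *m E *m R = block_mx 1%:M 0 0 0].
Proof.
(* The size equations can be substituted only when [m'] and [n'] are variables on which the rank
   does not depend, hence the generalization. *)
have H r k l m' n' (L : 'M[F]_m') (U : 'M[F]_n') :
    m' = (r + k)%N -> n' = (r + l)%N -> L \in unitmx -> U \in unitmx ->
  exists k l (P : 'M_(r + k, m')) P' (R : 'M_(n', r + l)) R',
    [/\ mutual_inverse P P', mutual_inverse R R' &
        P *m (L *m pid_mx r *m U) *m R = block_mx 1%:M 0 0 0].
  move=> em en; subst m' n' => Lu Uu.
  exists k, l, (invmx L), L, (invmx U), U; split.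
  - exact/mutual_inverse_sym/mutual_inverse_unit.
  - exact/mutual_inverse_sym/mutual_inverse_unit.
  - by rewrite -!mulmxA mulKmx // mulmxV // mulmx1 pid_mx_block.
have := H (\rank E) (m - \rank E)%N (n - \rank E)%N _ _ (col_ebase E) (row_ebase E).
rewrite mulmx_ebase => {}H; exists (\rank E); apply: H;
  rewrite ?subnKC ?rank_leq_row ?rank_leq_col //.
  exact: col_ebase_unit.
exact: row_ebase_unit.
Qed.

(** Since [X *m Y] is idempotent, so is [e = 1 - X *m Y]; a full-rank factorization [e = N *m M]
    supplies a basis of the complement [ker Y] together with its dual coordinates. *)
Lemma complete_split_mono n d (X : 'M[F]_(n, d)) (Y : 'M[F]_(d, n)) :
  Y *m X = 1%:M ->
  exists k (N : 'M[F]_(n, k)) (M : 'M[F]_(k, n)),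
    [/\ mutual_inverse (row_mx X N) (col_mx Y M), Y *m N = 0 & M *m X = 0].
Proof.
move=> YX; pose e := 1%:M - X *m Y.
have eX : e *m X = 0 by rewrite mulmxBl mul1mx -mulmxA YX mulmx1 subrr.
have Ye : Y *m e = 0 by rewrite mulmxBr mulmx1 mulmxA YX mul1mx subrr.
have ee : e *m e = e by rewrite [LHS]mulmxBl mul1mx -(mulmxA X) Ye mulmx0 subr0.
have [L LN] := row_fullP (col_base_full e).
have [K MK] := row_freeP (row_base_free e).
have NM := mulmx_base e.
move: (\rank e) (col_base e) (row_base e) L LN K MK NM => k N M L LN K MK NM.
have YN : Y *m N = 0 by rewrite -(mulmx1 N) -MK (mulmxA N) NM mulmxA Ye mul0mx.
have MX : M *m X = 0 by rewrite -(mul1mx M) -LN -(mulmxA L) NM -mulmxA eX mulmx0.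
(* Cancelling [L] and [K] around [e *m e = e], with [e = N *m M], leaves [M *m N] on one side and
   the identity on the other. *)
have MN : M *m N = 1%:M.
  have : L *m (e *m e) *m K = 1%:M by rewrite ee -NM mulmxA LN mul1mx MK.
  rewrite -{1 2}NM => <-.
  by rewrite !mulmxA LN mul1mx -!mulmxA MK mulmx1.
exists k, N, M; split => //; split.
  by rewrite mul_row_col NM /e addrC subrK.
by rewrite mul_col_row YX YN MX MN -scalar_mx_block.
Qed.

End Equivalence.

(** * Pairs whose first matrix is [diag(I, 0)], and the moves that preserve this shape *)

Section Reduced.
Variable F : fieldType.

(** The zero upper right block is what the symmetry of [E^T Q] forces once [E = diag(I, 0)]; here
    [E^T Q = diag(A, 0)], so only [A] inherits the symmetry. *)
Definition reduced r k (A : 'M[F]_r) (B : 'M[F]_(k, r)) (C : 'M[F]_k) : mxpair F :=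
  mkpair (block_mx 1%:M 0 0 0) (block_mx A 0 B C).

Let simp := (mulmx0, mul0mx, mulmx1, mul1mx, addr0, add0r).

(** Take [U = diag(P^-1, X^-T)] and [V = diag(P, Y)]. Keeping the block [I] ties the first blocks
    together, so [A] moves by congruence, while [X] and [Y] remain independent. *)
Lemma reduced_conj r r' k k' (A : 'M[F]_r) (B : 'M[F]_(k, r)) (C : 'M[F]_k)
    (P : 'M_(r, r')) P' (X : 'M_(k', k)) X' (Y : 'M_(k, k')) Y' :
  mutual_inverse P P' -> mutual_inverse X X' -> mutual_inverse Y Y' ->
  pequiv (reduced A B C)
         (reduced (P^T *m A *m P) (X *m B *m P) (X *m C *m Y)).
Proof.
move=> iP iX iY.
exists (block_mx P' 0 0 X'^T), (block_mx P 0 0 X^T).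
exists (block_mx P 0 0 Y), (block_mx P' 0 0 Y').
split; rewrite /pfst /psnd /=.
- apply: mutual_inverse_diag; first exact: mutual_inverse_sym.
  exact/mutual_inverse_tr/mutual_inverse_sym.
- exact: mutual_inverse_diag.
- by rewrite !mulmx_block !simp (proj2 iP).
- by rewrite tr_block_mx !trmx0 trmxK !mulmx_block !simp.
Qed.

(** Adding multiples of the last columns to the first ones leaves [diag(I, 0)] unchanged, because
    its last columns vanish. *)
Lemma reduced_shear_right r k (A : 'M[F]_r) (B Z : 'M[F]_(k, r)) (C : 'M[F]_k) :
  pequiv (reduced A B C) (reduced A (B + C *m Z) C).
Proof.
exists 1%:M, 1%:M, (block_mx 1%:M 0 Z 1%:M), (block_mx 1%:M 0 (- Z) 1%:M).
split; rewrite /pfst /psnd /= ?trmx1 ?mul1mx.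
- exact: mutual_inverse1.
- exact: mutual_inverse_lshear.
- by rewrite mulmx_block !simp.
- by rewrite mulmx_block !simp.
Qed.

(** Dually, [U] adds multiples of the zero rows of [diag(I, 0)], while [U^-T] adds [Z *m A] to the
    lower rows of the second matrix. *)
Lemma reduced_shear_left r k (A : 'M[F]_r) (B Z : 'M[F]_(k, r)) (C : 'M[F]_k) :
  pequiv (reduced A B C) (reduced A (B + Z *m A) C).
Proof.
exists (block_mx 1%:M 0 (- Z) 1%:M)^T, (block_mx 1%:M 0 Z 1%:M)^T, 1%:M, 1%:M.
split; rewrite /pfst /psnd /= ?trmxK ?mulmx1.
- exact/mutual_inverse_tr/mutual_inverse_sym/mutual_inverse_lshear.
- exact: mutual_inverse1.
- by rewrite tr_block_mx !trmx0 !trmx1 mulmx_block !simp.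
- by rewrite mulmx_block !simp addrC.
Qed.

Lemma reduced_dsum r1 r2 k1 k2 (A1 : 'M[F]_r1) (A2 : 'M[F]_r2)
    (B1 : 'M[F]_(k1, r1)) (B2 : 'M[F]_(k2, r2)) (C1 : 'M[F]_k1) (C2 : 'M[F]_k2) :
  pequiv (reduced (block_mx A1 0 0 A2) (block_mx B1 0 0 B2) (block_mx C1 0 0 C2))
         (dsum (reduced A1 B1 C1) (reduced A2 B2 C2)).
Proof.
(* [S] is the permutation exchanging the two middle blocks. Its transpose is its inverse, so
   [U^-T = U] and both matrices of the pair are permuted alike. *)
pose S a b c d : 'M[F]_((a + b) + (c + d), (a + c) + (b + d)) :=
  block_mx (block_mx 1%:M 0 0 0) (block_mx 0 0 1%:M 0)
           (block_mx 0 1%:M 0 0) (block_mx 0 0 0 1%:M).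
have ST a b c d : (S a b c d)^T = S a c b d.
  by rewrite /S !tr_block_mx !trmx0 !trmx1.
have SS a b c d : S a b c d *m S a c b d = 1%:M.
  rewrite /S !mulmx_block !simp !add_block_mx !simp.
  by rewrite -!scalar_mx_block !block_mx0 -!scalar_mx_block.
have iS a b c d : mutual_inverse (S a b c d) (S a c b d) by split.
exists (S r1 k1 r2 k2), (S r1 r2 k1 k2), (S r1 r2 k1 k2), (S r1 k1 r2 k2).
split; rewrite /pfst /psnd /= ?ST ?simp //.
  by rewrite /S (@scalar_mx_block _ r1) !mulmx_block !simp ?add_block_mx
    ?mulmx_block !simp ?block_mx0.
rewrite /S !mulmx_block !simp !add_block_mx !simp !mulmx_block !simp.
by rewrite !add_block_mx !simp !block_mx0.
Qed.

End Reduced.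

Lemma unitmx_H2 (F : fieldType) : H2 (-1 : F) \in unitmx.
Proof.
have /mulmx1_unit[] // :
    (H2 (-1) : 'M[F]_(1 + 1)) *m (block_mx 0 (-1)%:M 1%:M 0 : 'M_(1 + 1)) = 1%:M.
rewrite mulmx_block !(mulmx0, mul0mx, mulmx1, mul1mx, addr0, add0r).
by rewrite mul_scalar_mx scale_scalar_mx mulrNN mulr1 -scalar_mx_block.
Qed.

(** * Existence of the canonical form *)

Section Existence.
Variable F : numClosedFieldType.
Variable c : symmetry_case.

(** With this sign both cases become one equation, and the reduction below runs uniformly. *)
Definition symmetry_sign : F := if c is Symmetric then 1 else -1.

Lemma has_symmetryE n (A : 'M[F]_n) :
  has_symmetry c A <-> A^T = symmetry_sign *: A.
Proof.
rewrite /symmetry_sign; case: c => /=.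
  by rewrite is_hermitianmxE expr0 map_mx_id // !scale1r; split => [/eqP|->].
rewrite is_hermitianmxE expr1 map_mx_id //; split => [/eqP {2}->|->];
  by rewrite scalerA mulN1r opprK scale1r.
Qed.

(* Over a quadratically closed field a nonzero symmetric form takes the value 1,
   and a nonzero alternating form has a hyperbolic pair. *)
Lemma nonzero_form_block r (A : 'M[F]_r) : A^T = symmetry_sign *: A -> A != 0 ->
  exists d (D : 'M[F]_d) (X : 'M[F]_(r, d)),
    [/\ (0 < d)%N, D \in unitmx, mkpair 1%:M D = MNpair F c & X^T *m A *m X = D].
Proof.
move=> symA /eqP/matrixP A0.
have [i [j Aij]] : exists i j, A i j != 0.
  apply: contra_notP A0 => nA i j; rewrite mxE; apply/eqP/negP => /negP Aij.
  by apply: nA; exists i, j.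
have eA k l : A l k = symmetry_sign * A k l.
  by move/matrixP: symA => /(_ k l); rewrite !mxE.
pose e k : 'cV[F]_r := delta_mx k 0.
have eAe k l : (e k)^T *m A *m e l = (A k l)%:M.
  rewrite trmx_delta -rowE -colE; apply/matrixP => a b.
  by rewrite !ord1 !mxE eqxx.
move: eA; rewrite /symmetry_sign; case: c => eA /=.
  have [x [a a0 xAx]] : exists x : 'cV[F]_r, exists2 a, a != 0 & x^T *m A *m x = a%:M.
    have [Aii|Aii] := eqVneq (A i i) 0; last by exists (e i), (A i i).
    have [Ajj|Ajj] := eqVneq (A j j) 0; last by exists (e j), (A j j).
    (* When both diagonal entries vanish, the form takes at [e i + e j] the value [2 A_ij], which is
       nonzero in characteristic zero. *)
    exists (e i + e j), (A i j *+ 2); first by rewrite mulrn_eq0.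
    rewrite [(_ + _)^T]raddfD /= !mulmxDl !mulmxDr !eAe Aii Ajj (eA i j) mul1r.
    by rewrite !raddf0 add0r addr0 -raddfD -mulr2n.
  have sa0 : sqrtC a != 0 by rewrite sqrtC_eq0.
  exists 1%N, 1%:M, ((sqrtC a)^-1 *: x); split => //; first exact: unitmx1.
  rewrite [(_ *: x)^T]linearZ /= -!scalemxAl -scalemxAr xAx !scale_scalar_mx.
  congr _%:M.
  by rewrite -[X in _ * (_ * X)](sqrtCK a) expr2 mulKf // mulVf.
have Akk k : A k k = 0.
  by have /eqP := eA k k; rewrite mulN1r -addr_eq0 -mulr2n mulrn_eq0 => /eqP.
(* Rescaling [e j] makes the form equal to 1 on the pair of columns; the diagonal of the resulting
   block vanishes by [Akk]. *)
exists 2, (H2 (-1)), (row_mx (e i) ((A i j)^-1 *: e j) : 'M_(_, 1 + 1)); split=> //.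
  exact: unitmx_H2.
rewrite tr_row_mx mul_col_mx mul_col_row [(_ *: _)^T]linearZ /=.
rewrite -!scalemxAl -!scalemxAr !eAe !Akk.
have s0 : 0%:M = 0 :> 'M[F]_1 by exact: raddf0.
by rewrite (eA i j) mulN1r !scale_scalar_mx !mulr0 mulrN mulVf // s0.
Qed.
Notation sgn := symmetry_sign.
Notation decomp := (decomposable (summand_types F c)).

Lemma mem_scalarpair10 : scalarpair 1 0 \in summand_types F c.
Proof. by rewrite !inE eqxx. Qed.

Lemma mem_scalarpair01 : scalarpair 0 1 \in summand_types F c.
Proof. by rewrite !inE eqxx ?orbT. Qed.

Lemma mem_scalarpair00 : scalarpair 0 0 \in summand_types F c.
Proof. by rewrite !inE eqxx ?orbT. Qed.

Lemma singpair_reduced :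
  reduced (0 : 'M[F]_1) (1%:M : 'M_1) (0 : 'M_1) = singpair F.
Proof.
rewrite singpairE /reduced; congr mkpair; apply/matrixP => i j;
  case: i => [[|[|//]] ?]; case: j => [[|[|//]] ?]; rewrite [RHS]mxE /block_mx mxE;
  do 2 (case: splitP => [[[|[|?]] ?]|[[|?] ?]] //= _; rewrite mxE) => //;
  rewrite ?castmxE /row_mx ?mxE //.
Qed.

Lemma decomposable_sing s : decomp (reduced (0 : 'M_s) 1%:M (0 : 'M_s)).
Proof.
elim: s => [|s IH]; first exact: decomposable_size0.
have -> : reduced (0 : 'M[F]_s.+1) 1%:M (0 : 'M_s.+1) =
    reduced (block_mx (0 : 'M_1) 0 0 (0 : 'M_s)) (block_mx 1%:M 0 0 1%:M)
            (block_mx (0 : 'M_1) 0 0 (0 : 'M_s)).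
  by rewrite !block_mx0 -!(@scalar_mx_block _ 1 s).
apply: decomposable_pequiv (reduced_dsum _ _ _ _ _ _) _.
apply: decomposable_dsum => //; apply: decomposable_mem.
by rewrite singpair_reduced !inE eqxx ?orbT.
Qed.

(** In the rank normal form of [B], the identity block yields singular pairs, the remaining columns
    yield (1,0)'s and the remaining rows yield (0,0)'s. *)
Lemma decomposable_lower r k (B : 'M[F]_(k, r)) :
  decomp (reduced (0 : 'M_r) B (0 : 'M_k)).
Proof.
have [s [k' [l [P [P' [R [R' [iP iR PBR]]]]]]]] := rank_normal_form B.
(* As [C = 0], any invertible right factor of the right shape will do; [P'] is at hand. *)
apply: decomposable_pequiv (reduced_conj _ _ _ iR iP (mutual_inverse_sym iP)) _.
rewrite PBR !(mulmx0, mul0mx) -[X in reduced X]block_mx0.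
rewrite -[X in reduced _ _ X]block_mx0.
apply: decomposable_pequiv (reduced_dsum _ _ _ _ _ _) _.
apply: decomposable_dsum; first exact: decomposable_sing.
have -> : reduced (0 : 'M[F]_l) 0 (0 : 'M_k') =
    dsum (@mkpair F l 1%:M 0%:M) (@mkpair F k' 0%:M 0%:M).
  by rewrite /reduced /dsum /pfst /psnd /= !raddf0.
apply: decomposable_dsum; apply: decomposable_scalar.
  exact: mem_scalarpair10.
exact: mem_scalarpair00.
Qed.

(** Strong induction on [r]: a nonzero form [A] has a nondegenerate block [D], which splits off
    along its orthogonal complement. *)
Lemma decomposable_left r k (A : 'M[F]_r) (B : 'M[F]_(k, r)) :
  A^T = sgn *: A -> decomp (reduced A B (0 : 'M_k)).
Proof.
have [m] := ubnP r; elim: m r A B => // m IH r A B le_r symA.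
have [->|A0] := eqVneq A 0; first exact: decomposable_lower.
have [d [D [X [d0 uD Dc XAX]]]] := nonzero_form_block symA A0.
(* This left inverse of [X] has as kernel the orthogonal complement of the columns of [X] for the
   form [A], so the complement [N] below makes [A] block diagonal. *)
pose Y := invmx D *m X^T *m A.
have YX : Y *m X = 1%:M by rewrite /Y -!mulmxA (mulmxA X^T) XAX mulVmx.
have [l [N [M [iP YN MX]]]] := complete_split_mono YX.
have XAN : X^T *m A *m N = 0.
  by have := congr1 (mulmx D) YN; rewrite /Y !mulmxA mulmxV // mul1mx mulmx0.
have NAX : N^T *m A *m X = 0.
  apply: trmx_inj; rewrite !trmx_mul trmxK symA -scalemxAl -scalemxAr mulmxA XAN.
  by rewrite scaler0 trmx0.
have rE := mutual_inverse_eq iP.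
have i1 := mutual_inverse1 F k.
apply: decomposable_pequiv (reduced_conj _ _ _ iP i1 i1) _.
rewrite mul1mx mulmx1 mulmx0 tr_row_mx mul_col_mx mul_col_row XAX XAN NAX mul_mx_row.
(* The left shear subtracts [B *m X], which is the part of [B] below [D]. *)
apply: decomposable_pequiv
  (reduced_shear_left _ _ (row_mx (- (B *m X *m invmx D)) 0) _) _.
rewrite mul_row_block !(mulmx0, mul0mx, addr0, add0r) mulNmx mulmxKV //.
rewrite add_row_mx subrr addr0.
(* Writing [k] as [0 + k] gives the block [D] no lower rows, so that its summand is just
   [(I, D)]. *)
have -> : row_mx 0 (B *m N) = block_mx (0 : 'M_(0, d)) 0 0 (B *m N) :> 'M_(0 + k, _).
  by rewrite block_mxEv [col_mx _ _]/col_mx; apply/matrixP => i j; rewrite [RHS]mxE;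
    case: splitP => [[]|i' ei] //; congr (row_mx _ _ _ _); exact: val_inj.
have -> : (0 : 'M[F]_k) = block_mx (0 : 'M_0) 0 0 0 :> 'M_(0 + k) by rewrite block_mx0.
apply: decomposable_pequiv (@reduced_dsum _ d l 0 k _ _ _ _ _ _) _.
apply: decomposable_dsum.
  rewrite -[reduced _ _ _]/(dsum (mkpair 1%:M D) (@mkpair F 0 0 0)) dsum_size0r // Dc.
  by apply: decomposable_mem; rewrite !inE eqxx ?orbT.
apply: IH.
  by move: le_r; rewrite rE ltnS; apply: leq_trans; rewrite -add1n leq_add2r.
by rewrite !trmx_mul trmxK symA -scalemxAl -scalemxAr mulmxA.
Qed.

(** The identity block in the rank normal form of [C] clears the rows of [B] beside it and splits
    off as (0,1)'s; what is left has [C = 0]. *)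
Lemma decomposable_reduced r k (A : 'M[F]_r) (B : 'M[F]_(k, r)) (C : 'M[F]_k) :
  A^T = sgn *: A -> decomp (reduced A B C).
Proof.
move=> symA.
have [s [l [l' [P [P' [R [R' [iP iR PCR]]]]]]]] := rank_normal_form C.
have ell : l' = l.
  by apply/(@addnI s); rewrite (mutual_inverse_eq iP) (mutual_inverse_eq iR).
subst l'.
apply: decomposable_pequiv (reduced_conj _ _ _ (mutual_inverse1 F r) iP iR) _.
rewrite trmx1 mul1mx !mulmx1 PCR -[P *m B]vsubmxK.
move: (usubmx _) (dsubmx _) => B1 B2.
apply: decomposable_pequiv (reduced_shear_right _ _ (col_mx (- B1) 0) _) _.
rewrite mul_block_col !(mul0mx, mulmx0, mul1mx, addr0) add_col_mx subrr addr0.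
have -> : col_mx 0 B2 = block_mx (0 : 'M_(s, 0)) 0 0 B2 :> 'M_(_, 0 + r).
  rewrite block_mxEh; apply/matrixP => i j; rewrite [RHS]mxE.
  by case: splitP => [[]|j' ej] //; congr (col_mx _ _ _ _); exact: val_inj.
have -> : A = block_mx (0 : 'M_0) 0 0 A :> 'M_(0 + r).
  apply/matrixP => i j.
  have e (a : 'I_r) : a = rshift 0 a by exact: val_inj.
  by rewrite [in RHS](e i) [in RHS](e j) block_mxEdr.
apply: decomposable_pequiv (@reduced_dsum _ 0 r s l _ _ _ _ _ _) _.
apply: decomposable_dsum; last exact: decomposable_left.
have -> : reduced (0 : 'M[F]_0) (0 : 'M_(s, 0)) 1%:M = @mkpair F s 0%:M 1%:M.
  rewrite -[reduced _ _ _]/(dsum (@mkpair F 0 1%:M 0) (@mkpair F s 0 1%:M)).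
  by rewrite dsum_size0l // raddf0.
exact/decomposable_scalar/mem_scalarpair01.
Qed.

Lemma decomposable_symmetric n (E Q : 'M[F]_n) :
  has_symmetry c (E^T *m Q) -> decomp (mkpair E Q).
Proof.
move=> /has_symmetryE symEQ.
have [r [k [l [P [P' [R [R' [iP iR PER]]]]]]]] := rank_normal_form E.
have ell : l = k.
  by apply/(@addnI r); rewrite -(mutual_inverse_eq iR) (mutual_inverse_eq iP).
subst l.
pose G := P'^T *m Q *m R.
have eq1 : pequiv (mkpair E Q) (mkpair (block_mx 1%:M 0 0 0) G).
  by exists P, P', R, R'.
apply: decomposable_pequiv eq1 _.
have symG : ((P *m E *m R)^T *m G)^T = sgn *: ((P *m E *m R)^T *m G).
  (* The factors [P^T] and [P'^T] cancel, so [E^T Q] moves by congruence and keeps its symmetry. *)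
  have -> : (P *m E *m R)^T *m G = R^T *m (E^T *m Q) *m R.
    rewrite !trmx_mul /G !mulmxA -(mulmxA _ P^T) -(trmx_mul P' P).
    by rewrite (proj2 iP) trmx1 mulmx1.
  by rewrite trmx_mul (trmx_mul R^T) symEQ trmxK -scalemxAl -scalemxAr !mulmxA.
move: symG; rewrite PER -[G]submxK.
move: (ulsubmx G) (ursubmx G) (dlsubmx G) (drsubmx G) => A Z B C.
rewrite tr_block_mx !trmx0 trmx1 mulmx_block.
rewrite !(mulmx0, mul0mx, mul1mx, addr0) tr_block_mx scale_block_mx !scaler0 !trmx0.
(* Now [E^T Q] has upper blocks [A] and [Z] and zero lower blocks; comparing it with its transpose
   gives the symmetry of [A] and [Z = 0]. *)
move=> /eq_block_mx[symA _ /(canRL (@trmxK _ _ _))].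
rewrite trmx0 => -> _.
exact: decomposable_reduced.
Qed.

Lemma canonical_form_exists n (E Q : 'M[F]_n) : (0 < n)%N ->
  has_symmetry c (E^T *m Q) ->
  exists f (s : f.-tuple (mxpair F)), canonical_form c E Q s.
Proof.
move=> n0 /decomposable_symmetric[s sT EQs].
exists (size s), (in_tuple s); split => //.
  (* An empty list of summands would have size 0, against [n > 0]. *)
  move: EQs; case: s {sT} => // -[U [U' [_ [_ [iU _ _ _]]]]].
  have := mutual_inverse_eq iU; rewrite psize_dsums_nil => e.
  by move: n0; rewrite -[n]e.
rewrite -/(dsums s); move: EQs; case: (dsums s) => m [X Y].
move=> [U [U' [V [V' [iU iV]]]]].
have e := mutual_inverse_eq iU; rewrite /psize /= in U U' V V' iU iV e *.
rewrite /pfst /psnd /=; subst m => -> ->.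
have [uU _] := mulmx1_unit (proj1 iU); have [uV _] := mulmx1_unit (proj1 iV).
exists U, V; split=> //; rewrite -[U' in RHS](mulKmx uU) (proj1 iU) mulmx1 //.
Qed.

End Existence.

(** * Rank invariants and their additivity *)

Section Ranks.
Variable F : fieldType.
Implicit Types p q x y : mxpair F.

Definition rank_fst p : nat := \rank (pfst p).
Definition rank_snd p : nat := \rank (psnd p).
Definition rank_form p : nat := \rank ((pfst p)^T *m psnd p).
Definition rank_stack p : nat := \rank (col_mx (pfst p) (psnd p)).
Definition pranks p :=
  (psize p, rank_fst p, rank_snd p, rank_form p, rank_stack p).

Lemma pranks_eq p q : pranks p = pranks q ->
  [/\ psize p = psize q, rank_fst p = rank_fst q, rank_snd p = rank_snd q,
      rank_form p = rank_form q & rank_stack p = rank_stack q].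
Proof. by case=> ? ? ? ? ?; split. Qed.

Lemma scalar11_eq0 (a : F) : (a%:M == 0 :> 'M_1) = (a == 0).
Proof. by rewrite -scalemx1 scalemx_eq0 oner_eq0 orbF. Qed.

Lemma rank_scalar11 (a : F) : \rank (a%:M : 'M_1) = (a != 0).
Proof. by rewrite rank_rV scalar11_eq0. Qed.

Lemma pranks_scalarpair (a b : F) :
  pranks (scalarpair a b) =
    (1%N, (a != 0) : nat, (b != 0) : nat, (a * b != 0) : nat,
     ((a != 0) || (b != 0)) : nat).
Proof.
rewrite /pranks /rank_fst /rank_snd /rank_form /rank_stack /psize /pfst /psnd /=.
congr (_, _, _, _, _); rewrite ?rank_scalar11 //.
  by rewrite tr_scalar_mx -scalar_mxM rank_scalar11.
rewrite -mxrank_tr tr_col_mx rank_rV row_mx_eq0 negb_and !tr_scalar_mx.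
by rewrite !scalar11_eq0.
Qed.

Lemma rank_fst_le_stack p : (rank_fst p <= rank_stack p)%N.
Proof. by rewrite /rank_stack -addsmxE; exact/mxrankS/addsmxSl. Qed.

Lemma rank_stack_le_size p : (rank_stack p <= psize p)%N.
Proof. exact: rank_leq_col. Qed.

Lemma pranks_singpair : pranks (singpair F) = (2, 1, 1, 0, 1)%N.
Proof.
have -> : singpair F = @mkpair F 2 (delta_mx 0 0) (delta_mx 1 0).
  by rewrite singpairE; congr mkpair; apply/matrixP => i j; rewrite !mxE.
(* Every row of the stack is a multiple of the first unit row vector, and the stack is nonzero. *)
have S1 : rank_stack (@mkpair F 2 (delta_mx 0 0) (delta_mx 1 0)) = 1%N.
  apply/eqP; rewrite eqn_leq; apply/andP; split.
    apply: leq_trans (rank_leq_row (delta_mx 0 0 : 'rV[F]_2)); apply: mxrankS.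
    rewrite col_mx_sub; apply/andP; split; rewrite /pfst /psnd /=.
      by rewrite -(mul_delta_mx (0 : 'I_1) 0 0) submxMl.
    by rewrite -(mul_delta_mx (0 : 'I_1) 1 0) submxMl.
  by apply: leq_trans (rank_fst_le_stack _); rewrite /rank_fst mxrank_delta.
rewrite /pranks S1 /rank_fst /rank_snd /rank_form /psize /pfst /psnd /=.
by rewrite !mxrank_delta trmx_delta mul_delta_mx_0 // mxrank0.
Qed.

Lemma pranks_unit n (D : 'M[F]_n) : D \in unitmx ->
  pranks (mkpair 1%:M D) = (n, n, n, n, n).
Proof.
move=> uD; have Sn : rank_stack (mkpair 1%:M D) = n.
  apply/eqP; rewrite eqn_leq; apply/andP; split.
    exact: rank_stack_le_size (mkpair 1%:M D).
  by apply: leq_trans (rank_fst_le_stack _); rewrite /rank_fst mxrank1.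
rewrite /pranks Sn /rank_fst /rank_snd /rank_form /psize /pfst /psnd /=.
by rewrite trmx1 mul1mx mxrank1 mxrank_unit.
Qed.

Lemma psize_MNpair_gt0 c : (0 < psize (MNpair F c))%N.
Proof. by case: c. Qed.

Lemma pranks_MNpair c (d := psize (MNpair F c)) :
  pranks (MNpair F c) = (d, d, d, d, d).
Proof.
by rewrite {}/d; case: c => /=; apply: pranks_unit; rewrite ?unitmx1 ?unitmx_H2.
Qed.

Lemma psize_dsum p q : psize (dsum p q) = (psize p + psize q)%N.
Proof. by []. Qed.

Lemma rank_fst_dsum p q : rank_fst (dsum p q) = (rank_fst p + rank_fst q)%N.
Proof. exact: rank_diag_block_mx. Qed.

Lemma rank_snd_dsum p q : rank_snd (dsum p q) = (rank_snd p + rank_snd q)%N.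
Proof. exact: rank_diag_block_mx. Qed.

Lemma rank_form_dsum p q : rank_form (dsum p q) = (rank_form p + rank_form q)%N.
Proof.
rewrite -[LHS]/(\rank ((block_mx _ _ _ _)^T *m block_mx _ _ _ _)).
rewrite tr_block_mx !trmx0 mulmx_block !(mulmx0, mul0mx, addr0, add0r).
exact: rank_diag_block_mx.
Qed.

(** Either row space is the sum of the four row spaces. Applied to the stack of a direct sum, this
    exchange makes it block diagonal. *)
Lemma rank_col_mxACA m1 m2 m3 m4 n (A : 'M[F]_(m1, n)) (B : 'M_(m2, n))
    (C : 'M_(m3, n)) (D : 'M_(m4, n)) :
  \rank (col_mx (col_mx A B) (col_mx C D)) =
  \rank (col_mx (col_mx A C) (col_mx B D)).
Proof.
apply/eqP; rewrite eqn_leq; apply/andP; split; apply: mxrankS;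
  rewrite !col_mx_sub.
  have := submx_refl (col_mx (col_mx A C) (col_mx B D)).
  by rewrite !col_mx_sub -!andbA => /and4P[-> -> -> ->].
have := submx_refl (col_mx (col_mx A B) (col_mx C D)).
by rewrite !col_mx_sub -!andbA => /and4P[-> -> -> ->].
Qed.

Lemma rank_stack_dsum p q :
  rank_stack (dsum p q) = (rank_stack p + rank_stack q)%N.
Proof.
rewrite -rank_diag_block_mx.
rewrite -[LHS]/(\rank (col_mx (block_mx _ _ _ _) (block_mx _ _ _ _))).
by rewrite !block_mxEv rank_col_mxACA -2!block_mxEv 2!block_mxEh !col_mx0.
Qed.

(** [E^T Q] becomes [V^T (E^T Q) V], and the stack is multiplied by [diag(U, U^-T)] on the left and
    by [V] on the right. *)
Lemma pranks_mul n (E Q U V : 'M[F]_n) : U \in unitmx -> V \in unitmx ->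
  pranks (mkpair (U *m E *m V) ((invmx U)^T *m Q *m V)) = pranks (mkpair E Q).
Proof.
move=> uU uV; have fV : row_free V by rewrite row_free_unit.
have uU' : (invmx U)^T \in unitmx by rewrite unitmx_tr unitmx_inv.
rewrite /pranks /rank_fst /rank_snd /rank_form /rank_stack /psize /pfst /psnd /=.
congr (_, _, _, _, _).
- by rewrite mxrankMfree // eqmxMfull ?row_full_unit.
- by rewrite mxrankMfree // eqmxMfull ?row_full_unit.
- rewrite !trmx_mul !mulmxA mxrankMfree // -!(mulmxA V^T).
  rewrite eqmxMfull ?row_full_unit ?unitmx_tr //.
  by rewrite -(mulmxA E^T) -trmx_mul mulVmx // trmx1 mulmx1.
- have -> : col_mx (U *m E *m V) ((invmx U)^T *m Q *m V) =
     block_mx U 0 0 (invmx U)^T *m col_mx E Q *m V.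
    by rewrite mul_block_col !mul0mx addr0 add0r mul_col_mx.
  rewrite mxrankMfree // eqmxMfull // row_full_unit unitmxE det_ublock unitrM.
  by rewrite -!unitmxE uU.
Qed.

End Ranks.

(** * Multiplicities of the summands in terms of ranks *)

Section Uniqueness.
Variable F : fieldType.
Implicit Types (c : symmetry_case) (s t : seq (mxpair F)).

Lemma pranks_summand c p : p \in summand_types F c ->
  let d := psize (MNpair F c) in
  [\/ p = scalarpair 1 0 /\ pranks p = (1, 1, 0, 0, 1)%N,
      p = scalarpair 0 1 /\ pranks p = (1, 0, 1, 0, 1)%N,
      p = scalarpair 0 0 /\ pranks p = (1, 0, 0, 0, 0)%N |
      p = singpair F /\ pranks p = (2, 1, 1, 0, 1)%N \/
      p = MNpair F c /\ pranks p = (d, d, d, d, d)].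
Proof.
rewrite !inE => /or4P[/eqP ->|/eqP ->|/eqP ->|/orP[]/eqP ->] d.
- by constructor 1; rewrite pranks_scalarpair oner_eq0 eqxx mulr0 eqxx.
- by constructor 2; rewrite pranks_scalarpair oner_eq0 eqxx mul0r eqxx.
- by constructor 3; rewrite pranks_scalarpair mulr0 eqxx.
- by constructor 4; left; rewrite pranks_singpair.
- by constructor 4; right; rewrite pranks_MNpair.
Qed.

(** The five types have distinct rank vectors, so membership counts turn into comparisons of
    numbers. *)
Lemma summand_eqE c p q :
  p \in summand_types F c -> q \in summand_types F c ->
  (p == q) = (pranks p == pranks q).
Proof.
move=> pT qT; apply/eqP/eqP => [-> //|].
have d0 := psize_MNpair_gt0 F c.
have [[-> ->]|[-> ->]|[-> ->]|[[-> ->]|[-> ->]]] := pranks_summand pT;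
have [[-> ->]|[-> ->]|[-> ->]|[[-> ->]|[-> ->]]] := pranks_summand qT => // -[]; lia.
Qed.

(** Both sides of each identity are additive, so it suffices to check each type once. For instance,
    the stack rank exceeds the rank of [Q] by 1 on (1,0) and by 0 on all other types. *)
Lemma count_summands c s (d := psize (MNpair F c)) :
  {subset s <= summand_types F c} ->
  [/\ (count_mem (scalarpair 1 0) s + rank_snd (dsums s) = rank_stack (dsums s))%N,
      (count_mem (scalarpair 0 1) s + rank_fst (dsums s) = rank_stack (dsums s))%N,
      (count_mem (scalarpair 0 0) s + rank_fst (dsums s) + rank_snd (dsums s) =
       psize (dsums s) + rank_form (dsums s))%N,
      (count_mem (singpair F) s + rank_stack (dsums s) + rank_form (dsums s) =
       rank_fst (dsums s) + rank_snd (dsums s))%N &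
      (count_mem (MNpair F c) s * d = rank_form (dsums s))%N].
Proof.
have d0 := psize_MNpair_gt0 F c; rewrite -/d in d0.
elim: s => [|p s IH] sT.
  have z m n (A : 'M[F]_(m, n)) : n = 0%N -> \rank A = 0%N.
    by move=> n0; apply/eqP; rewrite -leqn0 -n0 rank_leq_col.
  have n0 := psize_dsums_nil F.
  by rewrite /rank_fst /rank_snd /rank_form /rank_stack !z // n0.
have pT : p \in summand_types F c by apply: sT; rewrite mem_head.
have {}IH := IH (fun x xs => sT x (mem_behead (xs : x \in behead (p :: s)))).
move: IH => [].
have T10 : scalarpair 1 0 \in summand_types F c by rewrite !inE eqxx.
have T01 : scalarpair 0 1 \in summand_types F c by rewrite !inE eqxx ?orbT.
have T00 : scalarpair 0 0 \in summand_types F c by rewrite !inE eqxx ?orbT.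
have Tsg : singpair F \in summand_types F c by rewrite !inE eqxx ?orbT.
have TMN : MNpair F c \in summand_types F c by rewrite !inE eqxx ?orbT.
rewrite dsums_cons psize_dsum rank_fst_dsum rank_snd_dsum rank_form_dsum.
rewrite rank_stack_dsum /=.
rewrite !(summand_eqE pT) // !pranks_scalarpair pranks_singpair pranks_MNpair -/d.
rewrite !oner_eq0 !mulr0 mul0r !eqxx /=.
have := pranks_summand pT; rewrite -/d => -[[_ e]|[_ e]|[_ e]|[[_ e]|[_ e]]];
  rewrite e; case: e => -> -> -> -> ->;
  rewrite !xpair_eqE ?eqxx ?(gtn_eqF d0) ?(ltn_eqF d0) ?andbF /=
    mulnDl ?mul0n ?mul1n;
  split; lia.
Qed.

End Uniqueness.

(** * Uniqueness and the Lagrangian case *)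

Section CanonicalForm.
Variable F : numClosedFieldType.
Implicit Types (c : symmetry_case).

Lemma canonical_form_pranks c n (E Q : 'M[F]_n) f (s : f.-tuple (mxpair F)) :
  canonical_form c E Q s -> pranks (mkpair E Q) = pranks (dsums s).
Proof. by move=> [_ _ [U [V [uU uV e]]]]; rewrite -bigdsum_val -e pranks_mul. Qed.

Lemma perm_eq_pranks c (s t : seq (mxpair F)) :
  {subset s <= summand_types F c} -> {subset t <= summand_types F c} ->
  pranks (dsums s) = pranks (dsums t) -> perm_eq s t.
Proof.
move=> sT tT /pranks_eq[en eE eQ eB eS]; apply/allP => x; rewrite mem_cat => xst.
have /pranks_summand xT : x \in summand_types F c by case/orP: xst => [/sT|/tT].
have d0 := psize_MNpair_gt0 F c.
have [s1 s2 s3 s4 s5] := count_summands sT.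
have [t1 t2 t3 t4 t5] := count_summands tT.
rewrite -en -eE -eQ -eB -eS in t1 t2 t3 t4 t5.
apply/eqP; case: xT => [[-> _]|[-> _]|[-> _]|[[-> _]|[-> _]]]; try lia.
(* For (M,N) the ranks give the multiplicity times [d], and [d > 0] cancels. *)
by apply/eqP; rewrite -(eqn_pmul2r d0) s5 t5.
Qed.

Lemma two_symmetries c c' n (A : 'M[F]_n) :
  has_symmetry c A -> has_symmetry c' A -> c = c' \/ A = 0.
Proof.
have A0 : A^T = A -> A^T = - A -> A = 0.
  move=> -> /eqP; rewrite -addr_eq0 -mulr2n -scaler_nat scaler_eq0 pnatr_eq0.
  by move=> /eqP.
move=> /has_symmetryE + /has_symmetryE; rewrite /symmetry_sign.
by case: c c' => -[]; rewrite ?scale1r ?scaleN1r; auto.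
Qed.

Lemma notin_MNpair c n (E Q : 'M[F]_n) f (s : f.-tuple (mxpair F)) :
  canonical_form c E Q s -> E^T *m Q = 0 -> MNpair F c \notin s.
Proof.
move=> cf EQ0; have [_ sT _] := cf.
have [_ _ _ _ sMN] := count_summands sT.
have [_ _ _ eB _] := pranks_eq (canonical_form_pranks cf).
move: sMN; rewrite -eB [rank_form _](_ : _ = 0%N); last first.
  by rewrite -[LHS]/(\rank (E^T *m Q)) EQ0 mxrank0.
move/eqP; rewrite muln_eq0 (gtn_eqF (psize_MNpair_gt0 F c)) orbF.
by move/eqP/count_memPn.
Qed.

(** The two forms may be taken under different symmetry cases, since [E^T Q = 0] is both symmetric
    and skew-symmetric. Then no (M,N) occurs in [s], and its other four types are common to both
    cases. *)
Lemma canonical_form_unique c c' n (E Q : 'M[F]_n) f g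
    (s : f.-tuple (mxpair F)) (t : g.-tuple (mxpair F)) :
  has_symmetry c (E^T *m Q) -> has_symmetry c' (E^T *m Q) ->
  canonical_form c E Q s -> canonical_form c' E Q t -> perm_eq s t.
Proof.
move=> sc sc' cs ct; have [_ sT _] := cs; have [_ tT _] := ct.
apply: (@perm_eq_pranks c') => //; last first.
  by rewrite -(canonical_form_pranks cs) -(canonical_form_pranks ct).
have [<- //|EQ0] := two_symmetries sc sc'.
have nMN := notin_MNpair cs EQ0.
move=> x xs; have xMN : x != MNpair F c by apply: contraNneq nMN => <-.
have := sT x xs; rewrite !inE (negPf xMN) orbF.
by case/or4P => ->; rewrite ?orbT.
Qed.

(** A span of dimension [n] makes the [n] columns linearly independent, so the transpose has trivial
    left kernel. *)
Lemma rank_colspan m n (A : 'M[F]_(m, n)) : \dim (colspan A) = n -> \rank A = n.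
Proof.
rewrite /colspan => dA.
have fA : free [seq col j A | j <- enum 'I_n].
  by rewrite /free dA size_map size_enum_ord.
rewrite -mxrank_tr; apply/eqP; apply: inj_row_free => v vA.
have sz : size [seq col j A | j <- enum 'I_n] == n by rewrite size_map size_enum_ord.
have nthc (j : 'I_n) : [seq col j A | j <- enum 'I_n]`_j = col j A.
  by rewrite (nth_map j) ?size_enum_ord // nth_ord_enum.
have /freeP/(_ (v 0)) := (fA : free (Tuple sz)).
move=> H; apply/rowP => j; rewrite mxE; apply: H.
transitivity (\sum_i v 0 i *: col i A).
  by apply: eq_bigr => i _; rewrite nthc.
apply: trmx_inj; rewrite trmx0 -vA mulmx_sum_row raddf_sum /=.
by apply: eq_bigr => i _; rewrite linearZ /= tr_col.
Qed.

Lemma lagrangian_colspan n (E Q : 'M[F]_n) : lagrangian (colspan (col_mx E Q)) ->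
  \rank (col_mx E Q) = n /\ E^T *m Q = Q^T *m E.
Proof.
case=> dS iso; split; first exact: rank_colspan.
apply/eqP; rewrite -subr_eq0; apply/eqP.
(* The difference is the Gram matrix of the symplectic form on the columns of the stack; isotropy
   kills its entries. *)
have -> : E^T *m Q - Q^T *m E = (col_mx E Q)^T *m sympl_mx F n *m col_mx E Q.
  rewrite /sympl_mx tr_col_mx mul_row_block mul_row_col !mulmx0 add0r addr0.
  by rewrite mulmxN !mulmx1 mulNmx addrC.
have colS i : col i (col_mx E Q) \in colspan (col_mx E Q).
  by apply/memv_span/map_f; rewrite mem_enum.
apply/matrixP => i j; rewrite [RHS]mxE.
have /matrixP/(_ 0 0) := iso _ _ (colS i) (colS j).
rewrite [RHS]mxE => <-.
by rewrite tr_col -row_mul colE mulmxA -row_mul -colE !mxE.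
Qed.

Lemma lagrangian_summands c n (E Q : 'M[F]_n) f (s : f.-tuple (mxpair F)) :
  has_symmetry c (E^T *m Q) -> lagrangian (colspan (col_mx E Q)) ->
  canonical_form c E Q s ->
  {subset s <= [:: scalarpair 1 0; scalarpair 0 1; scalarpair 1 1]}.
Proof.
move=> sc /lagrangian_colspan[rS symEQ] cf x xs.
have [_ sT _] := cf.
have [_ _ s3 s4 _] := count_summands sT.
have [en _ _ _ eS] := pranks_eq (canonical_form_pranks cf).
have rn : rank_stack (dsums s) = psize (dsums s) by rewrite -eS -en.
(* With stack rank equal to size, the counts of (0,0) and of the singular pair are opposite
   integers, so both vanish. *)
have zeros (z g m e q b : nat) :
    (z + e + q = m + b -> g + m + b = e + q -> z = 0 /\ g = 0)%N by lia.
rewrite rn in s4; have [/count_memPn n00 /count_memPn nsg] := zeros _ _ _ _ _ _ s3 s4.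
have := sT x xs; rewrite !inE.
have /negPf -> : x != scalarpair 0 0 by apply: contraNneq n00 => <-.
have /negPf -> : x != singpair F by apply: contraNneq nsg => <-.
have symS : has_symmetry Symmetric (E^T *m Q).
  by apply/has_symmetryE; rewrite scale1r trmx_mul trmxK symEQ.
(* In the symmetric case (M,N) is (1,1), which is allowed; otherwise [E^T Q = 0] and (M,N) does not
   occur. *)
have [e|EQ0] := two_symmetries sc symS; first by rewrite e.
have nMN := notin_MNpair cf EQ0.
have /negPf -> : x != MNpair F c by apply: contraNneq nMN => <-.
by case/or3P => // ->; rewrite ?orbT.
Qed.

End CanonicalForm.

Theorem theorem3p16 (R : realType) (n : nat) (n_gt0 : (0 < n)%N)
    (E Q : 'M[R[i]]_n) (c : symmetry_case)
    (EQ_sym : has_symmetry c (E^T *m Q)) :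
  [/\ exists (f : nat) (s : f.-tuple (mxpair R[i])), canonical_form c E Q s,
      (forall (c' : symmetry_case) (f g : nat) (s : f.-tuple (mxpair R[i]))
              (t : g.-tuple (mxpair R[i])),
         has_symmetry c' (E^T *m Q) ->
         canonical_form c E Q s -> canonical_form c' E Q t -> perm_eq s t) &
      (lagrangian (colspan (col_mx E Q)) ->
       forall (f : nat) (s : f.-tuple (mxpair R[i])), canonical_form c E Q s ->
         {subset s <= [:: scalarpair 1 0; scalarpair 0 1; scalarpair 1 1]})].
Proof.
split.
- exact: canonical_form_exists.
- by move=> c' f g s t sc'; exact: canonical_form_unique.
- by move=> lag f s; exact: lagrangian_summands.
Qed.
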